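(* The Greedy-strategy is $(2+o_m(1))\frac{m}{H_m}$-competitive for Machine Covering on $m$ machines in the random-order model, where $H_m=\sum_{i=1}^m \frac1i$ is the $m$-th harmonic number. Furthermore this bound cannot be improved by more than a factor of $2+o_m(1)$, i.e. the competitive ratio of the Greedy-strategy in the random-order model is at least $(1-o_m(1))\frac{m}{H_m}$; in particular it is $\Theta\!\left(\frac{m}{\log m}\right)$.
   Context: Machine Covering: an input is a set $\mathcal{J}$ of $n$ jobs with non-negative sizes, to be assigned to $m$ identical parallel machines; the load of a machine is the total size of its jobs, and the objective is to maximize the minimum machine load; $\mathrm{OPT}(\mathcal{J})$ is the optimal offline minimum load. Online, jobs are revealed one by one and each is assigned irrevocably upon arrival. The Greedy-strategy (Graham's) assigns each arriving job to a currently least loaded machine, breaking ties arbitrarily. In the random-order model the adversary picks the set $\mathcal{J}$ and the arrival order $\sigma$ is uniform over $S_n$; an algorithm $A$ has random-order value $A^{\mathrm{rom}}(\mathcal{J})=\mathbb{E}_{\sigma}[A(\mathcal{J}^\sigma)]$, where $A(\mathcal{J}^\sigma)$ is its minimum load on that order, and its competitive ratio is $\sup_{\mathcal{J}}\mathrm{OPT}(\mathcal{J})/A^{\mathrm{rom}}(\mathcal{J})$ (with $0/0=1$, $a/0=\infty$ for $a>0$). $o_m(1)$ denotes a quantity tending to $0$ as $m\to\infty$. *)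

(* Defs.v *)
From HB Require Import structures.
From mathcomp Require Import all_boot all_order all_algebra all_fingroup.
From mathcomp Require Import all_classical all_reals all_analysis.
Set Implicit Arguments. Unset Strict Implicit. Unset Printing Implicit Defensive.
Import Order.TTheory GRing.Theory Num.Theory.
Local Open Scope ring_scope.

Section MachineCovering.
Variable R : realType.

Definition total (n : nat) (p : 'I_n -> R) : R := \sum_(i < n) p i.

(* Minimum machine load of a load vector on m machines; [ub] is used as the
   neutral element of min (any upper bound on all loads, e.g. the total). *)
Definition min_load (m : nat) (ub : R) (L : 'I_m -> R) : R :=
  \big[Order.min/ub]_(j < m) L j.

Definition OPT (m n : nat) (p : 'I_n -> R) : R :=
  \big[Order.max/0]_(f : {ffun 'I_n -> 'I_m})
     min_load (total p) (fun j => \sum_(i < n | f i == j) p i).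

(* A tie-breaking rule for Greedy: given the history of jobs revealed so far
   and the current loads, it picks a machine; it is valid if the chosen
   machine is always a least loaded one. *)
Definition valid_tiebreak (m : nat) (tb : seq R -> ('I_m -> R) -> 'I_m) :=
  forall (h : seq R) (L : 'I_m -> R) (j : 'I_m), L (tb h L) <= L j.

Definition greedy_step (m : nat) (tb : seq R -> ('I_m -> R) -> 'I_m)
    (st : seq R * ('I_m -> R)) (x : R) : seq R * ('I_m -> R) :=
  (rcons st.1 x, fun j => if j == tb st.1 st.2 then st.2 j + x else st.2 j).

Definition greedy_loads (m : nat) (tb : seq R -> ('I_m -> R) -> 'I_m)
    (s : seq R) : 'I_m -> R :=
  (foldl (greedy_step tb) ([::], fun _ => 0) s).2.

Definition greedy_val (m n : nat) (tb : seq R -> ('I_m -> R) -> 'I_m)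
    (p : 'I_n -> R) (sigma : 'S_n) : R :=
  min_load (total p) (greedy_loads tb [seq p (sigma t) | t <- enum 'I_n]).

Definition greedy_rom (m n : nat) (tb : seq R -> ('I_m -> R) -> 'I_m)
    (p : 'I_n -> R) : R :=
  (n`!%:R)^-1 * \sum_(sigma : 'S_n) greedy_val tb p sigma.

Definition ratio (a b : R) : \bar R :=
  if b == 0 then (if a == 0 then 1%E else +oo%E) else (a / b)%:E.

Definition greedy_cr (m : nat) (tb : seq R -> ('I_m -> R) -> 'I_m) : \bar R :=
  ereal_sup [set r | exists (n : nat) (p : 'I_n -> R),
     (forall i, 0 <= p i) /\ r = ratio (OPT m p) (greedy_rom tb p)].

Definition harmonic_number (m : nat) : R := \sum_(i < m) (i.+1%:R)^-1.

End MachineCovering.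

(* Main.v *)
(** Call a job large if its size is at least a, and let phi be the sum of
    p_x / (m - L_x) over the small jobs x, where L_x is the number of large jobs
    arriving before x.  As long as some machine has load below a, the large jobs
    sit alone on top of distinct machines and each small job is added to one of
    the m - L_x machines without a large job.  A large job removes a least loaded
    machine, so the average load of the remaining ones is at least phi; their
    loads differ by at most a, hence Greedy reaches min (a, phi - a).

    In random order L_x is uniform on {0, .., k}, k being the number of large
    jobs.  Since m - k machines of an optimal schedule hold only small jobs, phi
    has mean at least H_m / m * OPT (unless the small jobs are so many that phi
    is this large surely), and its relative variance is O(1 / H_m).  With
    a = H_m / (2 m) * OPT this gives the factor 2 + o(1).

    For the lower bound, m - 1 jobs of size 2 and many tiny jobs of total size 1
    have OPT >= 1, while Greedy balances the tiny jobs over the machines without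
    a large job and ends with load about phi, of mean H_m / m. *)
Require Import Defs.
From HB Require Import structures.
From mathcomp Require Import all_boot all_order all_algebra all_fingroup.
From mathcomp Require Import all_classical all_reals all_analysis.
From mathcomp Require Import ring lra zify.
Import Order.TTheory GRing.Theory Num.Theory.
Import numFieldNormedType.Exports.
Set Implicit Arguments. Unset Strict Implicit. Unset Printing Implicit Defensive.
Local Open Scope ring_scope.

(** * Ranks of jobs in a uniformly random order *)

Section RandomOrder.
Variables (R : realType) (n : nat).
Implicit Types (B S : {set 'I_n}) (tau sigma pi : 'S_n) (x y z : 'I_n).
Implicit Types f g : nat -> R.

(** Here [tau] sends a job to its position; it is the inverse of an arrival order [sigma], which
    sends a position to a job. *)
Definition nbefore B tau x : nat := #|[set w in B | (tau w < tau x)%N]|.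

Lemma nbefore_le B tau x : (nbefore B tau x <= #|B|)%N.
Proof. by apply/subset_leq_card/fintype.subsetP => w; rewrite inE => /andP[]. Qed.

Lemma nbefore_permM B pi tau x :
  nbefore B (pi * tau)%g x = nbefore (pi @: B) tau (pi x).
Proof.
rewrite /nbefore -(card_imset _ (@perm_inj _ pi)); apply: eq_card => w.
apply/imsetP/idP.
  by case=> v; rewrite !inE !permM => /andP[vB vx] ->; rewrite imset_f.
rewrite inE => /andP[/imsetP[v vB ->] vx]; exists v => //.
by rewrite inE vB !permM.
Qed.

Lemma tperm_setD1 S x z : x \in S -> z \in S -> tperm x z @: (S :\ x) = S :\ z.
Proof.
move=> xS zS; apply/setP => w; rewrite !inE.
apply/imsetP/andP.
  case=> v; rewrite !inE => /andP[vx vS ->].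
  case: tpermP => [e|e|/eqP vx' /eqP vz] //; first by rewrite e eqxx in vx.
  by rewrite -e eq_sym vx.
case=> wz wS; exists (tperm x z w); last by rewrite tpermK.
rewrite !inE; case: tpermP => [e|e|/eqP ? /eqP ?]; last by rewrite wS andbT.
  by rewrite zS andbT -e eq_sym.
by rewrite e eqxx in wz.
Qed.

Lemma tperm_setD1_sum (F : {set 'I_n} -> 'S_n -> 'I_n -> R) S x z :
    x \in S -> z \in S ->
    (forall B pi tau w, F B (pi * tau)%g w = F (pi @: B) tau (pi w)) ->
  \sum_tau F (S :\ x) tau x = \sum_tau F (S :\ z) tau z.
Proof.
move=> xS zS HF.
rewrite (reindex_inj (mulgI (tperm x z))); apply: eq_bigr => tau _.
by rewrite HF tpermL tperm_setD1.
Qed.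

Lemma nbeforeD1 S tau z : nbefore (S :\ z) tau z = nbefore S tau z.
Proof.
apply: eq_card => w; rewrite !inE; case: eqP => //= ->.
by rewrite ltnn andbF.
Qed.

Lemma nbefore_mono S tau z y : z \in S ->
  (nbefore S tau z < nbefore S tau y)%N = (tau z < tau y)%N.
Proof.
move=> zS; apply/idP/idP => [|zy].
  apply: contraTT; rewrite -!leqNgt => yz.
  apply/subset_leq_card/fintype.subsetP => w; rewrite !inE => /andP[-> wy] /=.
  exact: leq_trans wy yz.
apply: proper_card; apply/properP; split.
  by apply/fintype.subsetP => w; rewrite !inE => /andP[-> wz]; apply: ltn_trans wz zy.
by exists z; rewrite !inE ?zS ?ltnn.
Qed.

Lemma nbefore_inj S tau : {in S &, injective (nbefore S tau)}.
Proof.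
move=> z y zS yS e; apply: (@perm_inj _ tau); apply/val_inj/eqP.
have := nbefore_mono tau y zS; have := nbefore_mono tau z yS.
rewrite e !ltnn eqn_leq => h1 h2.
by rewrite (leqNgt (tau z)) (leqNgt (tau y)) -h1 -h2.
Qed.

(** The ranks of the elements of [S] within [S] are distinct and below [#|S|], so each value occurs
    exactly once. *)
Lemma sum_nbefore S tau g :
  \sum_(z in S) g (nbefore S tau z) = \sum_(i < #|S|) g i.
Proof.
rewrite -big_enum -(big_map (nbefore S tau) xpredT g) -(big_mkord xpredT g).
apply: perm_big; rewrite /index_iota subn0.
have U : uniq [seq nbefore S tau z | z <- enum S].
  rewrite map_inj_in_uniq ?enum_uniq // => z y.
  by rewrite !mem_enum; apply: nbefore_inj.
have sub : {subset [seq nbefore S tau z | z <- enum S] <= iota 0 #|S|}.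
  move=> i /mapP[z]; rewrite mem_enum => zS ->.
  rewrite mem_iota add0n /= -nbeforeD1 (cardsD1 z S) zS add1n ltnS.
  exact: nbefore_le.
have [|_ e] := uniq_min_size U sub; first by rewrite size_iota size_map cardE.
by apply: uniq_perm => //; apply: iota_uniq.
Qed.

(** This says that the rank of [x] is uniform on 0..[#|B|]. By symmetry any [z] in [x |: B] may play
    the role of [x]; summed over all such [z], the ranks run through every value once, whatever
    [tau] is. *)
Lemma sum_perm_nbefore B x g : x \notin B ->
  #|B|.+1%:R * \sum_tau g (nbefore B tau x) =
  n`!%:R * \sum_(i < #|B|.+1) g i.
Proof.
move=> xB; pose S := x |: B.
have cS : #|S| = #|B|.+1 by rewrite cardsU1 xB.
have SB : S :\ x = B by rewrite setU1K.
have -> : n`!%:R * \sum_(i < #|B|.+1) g i =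
    \sum_(tau : 'S_n) \sum_(z in S) g (nbefore S tau z).
  transitivity (\sum_(tau : 'S_n) \sum_(i < #|B|.+1) g i).
    by rewrite sumr_const card_Sn mulr_natl.
  by apply: eq_bigr => tau _; rewrite -cS (sum_nbefore S tau g).
rewrite exchange_big /= -cS mulr_natl -sumr_const; apply: eq_bigr => z zS.
under [RHS]eq_bigr do rewrite -nbeforeD1.
rewrite -{1}SB.
apply: (tperm_setD1_sum (F := fun B tau x => g (nbefore B tau x))) => //.
  by rewrite setU11.
by move=> *; rewrite nbefore_permM.
Qed.

Lemma nbefore_setD1 S tau y z : z \in S -> y \notin S ->
  nbefore (S :\ z) tau y =
  (nbefore S tau y - (nbefore S tau z < nbefore S tau y))%N.
Proof.
move=> zS yS; rewrite nbefore_mono // {2}/nbefore (cardsD1 z) inE zS /=.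
rewrite addKn; apply: eq_card => w; rewrite !inE.
by rewrite -andbA.
Qed.

(* As r runs over 0..k+1, the value r - [i < r] runs over 0..k, taking the
   value i twice. *)
Lemma sum_skip f k i : (i <= k)%N ->
  \sum_(r < k.+2) f (r - (i < r))%N = \sum_(r < k.+1) f r + f i.
Proof.
elim: k => [|k IH] ik.
  move: ik; rewrite leqn0 => /eqP ->.
  by rewrite !big_ord_recr !big_ord0 /= !add0r.
rewrite big_ord_recr /=; move: ik; rewrite leq_eqVlt => /orP[/eqP ->|ik].
  rewrite leqnn subn1 /=; congr (_ + _); apply: eq_bigr => r _.
  by rewrite ltnNge -ltnS ltn_ord subn0.
rewrite IH // [in RHS]big_ord_recr /= addrAC.
by rewrite (_ : i < k.+2)%N ?subn1 //; lia.
Qed.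

(** The joint law of two ranks comes from averaging twice: first over the element [z] of [x |: B]
    that plays the role of [x], then over the rank of [y] with respect to [x |: B], which is
    uniform. *)
Lemma sum_perm_nbefore2 B x y f : x \notin B -> y \notin B -> x != y ->
  #|B|.+1%:R * #|B|.+2%:R *
    \sum_tau f (nbefore B tau x) * f (nbefore B tau y) =
  n`!%:R * ((\sum_(i < #|B|.+1) f i) ^+ 2 + \sum_(i < #|B|.+1) f i ^+ 2).
Proof.
move=> xB yB xy; pose S := x |: B; set k := #|B|.
have cS : #|S| = k.+1 by rewrite cardsU1 xB.
have SB : S :\ x = B by rewrite setU1K.
have yS : y \notin S by rewrite !inE negb_or eq_sym xy.
have xS : x \in S by rewrite setU11.
pose F B tau z := f (nbefore B tau z) * f (nbefore B tau y).
have symF z : z \in S ->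
    \sum_tau F (S :\ x) tau x = \sum_tau F (S :\ z) tau z.
  move=> zS; rewrite (reindex_inj (mulgI (tperm x z))).
  apply: eq_bigr => tau _; rewrite /F !nbefore_permM tpermL tperm_setD1 //.
  by rewrite tpermD //; apply: contraNneq yS => <-.
(* If [z] has rank [i] in [S], deleting [z] lowers the rank of [y] by one exactly when [i] is below
   it. *)
have E1 : k.+1%:R * \sum_tau f (nbefore B tau x) * f (nbefore B tau y) =
    \sum_tau \sum_(i < k.+1)
      f i * f (nbefore S tau y - (i < nbefore S tau y))%N.
  transitivity (\sum_(z in S) \sum_tau F (S :\ z) tau z).
    rewrite -cS mulr_natl -sumr_const; apply: eq_bigr => z zS.
    by rewrite -symF // SB.
  rewrite exchange_big /=; apply: eq_bigr => tau _.
  rewrite -cS -(sum_nbefore S tau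
    (fun i => f i * f (nbefore S tau y - (i < nbefore S tau y))%N)).
  by apply: eq_bigr => z zS; rewrite /F nbeforeD1 nbefore_setD1.
rewrite mulrAC E1 mulrC.
have := sum_perm_nbefore
  (fun r => \sum_(i < k.+1) f i * f (r - (i < r))%N) yS.
rewrite cS => ->; congr (_ * _).
rewrite exchange_big /= expr2 mulr_suml -big_split /=; apply: eq_bigr => i _.
have ik : (i <= k)%N by rewrite -ltnS.
by rewrite -mulr_sumr sum_skip // mulrDr -expr2.
Qed.

End RandomOrder.

(** * Greedy on a fixed sequence of jobs *)

Section GreedySequence.
Variables (R : realType) (m : nat).
Implicit Types (a e : R) (s : seq R) (x : R).

Definition nlarge a s : nat := count (fun x => a <= x) s.

(* The load that the jobs smaller than [a] would bring to each machine without
   a large job, if each of them were split evenly among these machines. *)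
Definition spread_load a s : R :=
  \sum_(t < size s | nth 0 s t < a)
     nth 0 s t / (m - nlarge a (take t s))%:R.

Lemma nlarge_rcons a s x : nlarge a (rcons s x) = (nlarge a s + (a <= x)%R)%N.
Proof. by rewrite /nlarge -cats1 count_cat /= addn0. Qed.

Lemma spread_load_rcons a s x :
  spread_load a (rcons s x) =
  spread_load a s + (if a <= x then 0 else x / (m - nlarge a s)%:R).
Proof.
rewrite /spread_load big_mkcond size_rcons big_ord_recr /=; congr (_ + _).
  rewrite [RHS]big_mkcond; apply: eq_bigr => t _ /=.
  by rewrite nth_rcons ltn_ord -cats1 takel_cat // ltnW.
by rewrite nth_rcons ltnn eqxx -cats1 takel_cat // take_size ltNge; case: leP.
Qed.

Variable tb : seq R -> ('I_m -> R) -> 'I_m.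
Hypothesis tb_valid : valid_tiebreak tb.

Let load := greedy_loads tb.

Lemma greedy_loads_rcons s x : exists2 j0 : 'I_m,
  (forall j, load s j0 <= load s j) &
  forall j, load (rcons s x) j = if j == j0 then load s j + x else load s j.
Proof.
rewrite /load /greedy_loads -cats1 foldl_cat /=.
set st := foldl _ _ s.
by exists (tb st.1 st.2) => // j; apply: tb_valid.
Qed.

Lemma greedy_loads_ge0 s j : all (fun x => 0 <= x) s -> 0 <= load s j.
Proof.
elim/last_ind: s j => [|s x IH] j //; rewrite all_rcons => /andP[x0 s0].
have [j0 _ ->] := greedy_loads_rcons s x.
by case: eqP => _; rewrite ?addr_ge0 ?IH.
Qed.

(** [C] is the set of machines without a large job; the last clause bounds their average load from
    below by [spread_load]. *)
Definition large_inv a s := exists C : {set 'I_m},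
  [/\ (#|C| + nlarge a s = m)%N,
      forall j, j \notin C -> a <= load s j,
      forall j j', j \in C -> load s j <= load s j' + a &
      #|C|%:R * spread_load a s <= \sum_(j in C) load s j].

(** A small job put on [C] raises both sides of the last clause by its size. A large job takes a
    least loaded machine out of [C], so the average over [C] does not drop. *)
Lemma load_ge_or_inv a s : 0 <= a -> all (fun x => 0 <= x) s ->
  (forall j, a <= load s j) \/ large_inv a s.
Proof.
move=> a0; elim/last_ind: s => [|s x IH].
  move=> _; right; exists [set: 'I_m]; split => //=.
  - by rewrite cardsT card_ord addn0.
  - by move=> j; rewrite inE.
  - by move=> j j' _; rewrite /load /greedy_loads /= add0r.
  - by rewrite /spread_load big_ord0 mulr0 sumr_ge0.
rewrite all_rcons => /andP[x0 s0].
have [j0 j0min Lx] := greedy_loads_rcons s x.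
have Lmono j : load s j <= load (rcons s x) j.
  by rewrite Lx; case: eqP => // _; rewrite lerDl.
have [Lge|[C [cardC outC nearC sumC]]] := IH s0.
  by left=> j; apply: le_trans (Lmono j).
(* If even a least loaded machine lies outside [C], all loads have reached [a]. *)
have [j0C|j0C] := boolP (j0 \in C); last first.
  left=> j; apply: le_trans (Lmono j); apply: le_trans (j0min j).
  exact: outC.
right.
have Cpos : (0 < #|C|)%N by apply/card_gt0P; exists j0.
have CE : (m - nlarge a s = #|C|)%N by rewrite -[X in (X - _)%N]cardC addnK.
have [ax|xa] := leP a x.
  exists (C :\ j0); split.
  - by rewrite nlarge_rcons ax addn1 addnS; move: cardC; rewrite (cardsD1 j0 C) j0C.
  - move=> j; rewrite !inE Lx negb_and negbK => /orP[->|jC].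
      apply: le_trans ax _; rewrite lerDr.
      exact: greedy_loads_ge0.
    by case: eqP => [e|_]; [rewrite e j0C in jC|exact: outC].
  - move=> j j'; rewrite !inE => /andP[/negPf jj0 jC]; rewrite {1}Lx jj0.
    by apply: le_trans (nearC j j' jC) _; rewrite lerD2r.
  - rewrite spread_load_rcons ax addr0.
    rewrite (eq_bigr (load s)); last first.
      by move=> j; rewrite !inE Lx => /andP[/negPf ->].
    have sumE : \sum_(j in C) load s j =
        load s j0 + \sum_(j in C :\ j0) load s j by rewrite (big_setD1 j0).
    rewrite sumE in sumC.
    have : #|C :\ j0|%:R * load s j0 <= \sum_(j in C :\ j0) load s j.
      by rewrite mulr_natl -sumr_const; apply: ler_sum => j _.
    have cE := cardsD1 j0 C; rewrite j0C in cE.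
    move: sumC; rewrite cE natrD mulrDl mul1r.
    set c := #|_|%:R; set P := spread_load a s; set T := \sum_(i in _) _.
    have : 0 <= c by rewrite ler0n.
    move=> c0 h1 h2; rewrite -(ler_pM2l (ltr_wpDl c0 ltr01)).
    have := ler_wpM2l c0 h1; lra.
exists C; split.
- by rewrite nlarge_rcons (leNgt a x) xa addn0.
- by move=> j /outC h; apply: le_trans (Lmono j).
- move=> j j' jC; apply: (@le_trans _ _ (load s j' + a)); last first.
    by rewrite lerD2r.
  rewrite Lx; case: eqP => [->|_]; last exact: nearC.
  by rewrite lerD // ltW.
- rewrite spread_load_rcons (leNgt a x) xa /= CE mulrDr mulrCA divff ?mulr1; last first.
    by rewrite pnatr_eq0 -lt0n.
  apply: (le_trans (lerD sumC (lexx x))).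
  rewrite (big_setD1 j0) //= [X in _ <= X](big_setD1 j0) //= Lx eqxx addrAC.
  by rewrite lerD2l; apply: ler_sum => j.
Qed.

Lemma greedy_loads_lower a s : 0 <= a -> all (fun x => 0 <= x) s ->
  (forall j, a <= load s j) \/
  (nlarge a s < m)%N /\ forall j, spread_load a s <= load s j + a.
Proof.
move=> a0 s0; have [|[C [cardC outC nearC sumC]]] := load_ge_or_inv a0 s0.
  by left.
have [C0|] := set_0Vmem C.
  by left=> j; apply: outC; rewrite C0 inE.
case=> j0 j0C; right.
have Cpos : (0 < #|C|)%N by apply/card_gt0P; exists j0.
split; first by lia.
move=> j; rewrite -(@ler_pM2l _ #|C|%:R) ?ltr0n //.
apply: le_trans sumC _; rewrite mulr_natl -sumr_const.
by apply: ler_sum => i /nearC.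
Qed.

(* With large jobs of size 2 and small jobs of size [e] and total size at most 1
   a second job never reaches a machine with a large job, and the loads of the
   other machines differ by at most [e]. *)
Definition two_size_inv e s := exists C : {set 'I_m},
  [/\ (#|C| + nlarge 2 s = m)%N,
      forall j, j \notin C -> 2 <= load s j,
      forall j j', j \in C -> j' \in C -> load s j <= load s j' + e,
      \sum_(j in C) load s j <= \sum_(x <- s | x < 2) x &
      \sum_(j in C) load s j <=
        #|C|%:R * (spread_load 2 s + (nlarge 2 s)%:R * e)].

Lemma two_size_invP e s : 0 <= e -> e < 2 ->
    all (fun x => (x == e) || (x == 2)) s ->
    \sum_(x <- s | x < 2) x <= 1 -> (nlarge 2 s < m)%N ->
  two_size_inv e s.
Proof.
move=> e0 e2; elim/last_ind: s => [|s x IH].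
  move=> _ _ _; exists [set: 'I_m]; split => //=.
  - by rewrite cardsT card_ord addn0.
  - by move=> j; rewrite inE.
  - by move=> j j' _; rewrite /load /greedy_loads /= add0r.
  - by rewrite big_nil big1.
  - by rewrite /spread_load big_ord0 mul0r addr0 mulr0 big1.
rewrite all_rcons => /andP[xe sE]; rewrite nlarge_rcons -cats1 big_cat cats1 /=.
rewrite big_cons big_nil => sum1 nlt.
have x0 : 0 <= x by case/orP: xe => /eqP ->.
have s0 : all (fun x => 0 <= x) s.
  by apply: sub_all sE => y /orP[] /eqP ->.
have sum1' : \sum_(y <- s | y < 2) y <= 1.
  by apply: le_trans sum1; rewrite lerDl; case: ifP => // _; rewrite addr0.
have [|C [cardC outC nearC totC sumC]] := IH sE sum1'; first by lia.
have [j0 j0min Lx] := greedy_loads_rcons s x.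
have Lge0 j : 0 <= load s j by exact: greedy_loads_ge0.
have [j1 j1C] : exists j, j \in C by apply/card_gt0P; lia.
have Lsmall j : j \in C -> load s j <= 1.
  move=> jC; apply: le_trans (le_trans totC sum1').
  by rewrite (big_setD1 j) //= lerDl sumr_ge0.
(* Loads in [C] are at most 1, those outside at least 2, so Greedy chooses inside [C]. *)
have j0C : j0 \in C.
  apply: contraT => /outC h.
  by have := le_trans h (le_trans (j0min j1) (Lsmall _ j1C)); lra.
have Cpos : (0 < #|C|)%N by apply/card_gt0P; exists j0.
have CE : (m - nlarge 2 s = #|C|)%N by rewrite -[X in (X - _)%N]cardC addnK.
have j0C' : \sum_(j in C) load s j =
    load s j0 + \sum_(j in C :\ j0) load s j by rewrite (big_setD1 j0).
have [x2|x2] := leP 2 x.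
  rewrite x2 in nlt.
  exists (C :\ j0).
  have sumE : \sum_(j in C :\ j0) load (rcons s x) j =
              \sum_(j in C :\ j0) load s j.
    by apply: eq_bigr => j; rewrite !inE Lx => /andP[/negPf ->].
  have cE := cardsD1 j0 C; rewrite j0C in cE.
  split.
  - by rewrite nlarge_rcons x2 addn1 addnS; move: cardC; rewrite (cardsD1 j0 C) j0C.
  - move=> j; rewrite !inE Lx negb_and negbK => /orP[->|jC].
      by apply: le_trans x2 _; rewrite lerDr.
    by case: eqP => [ej|_]; [rewrite ej j0C in jC|exact: outC].
  - move=> j j'; rewrite !inE !Lx => /andP[/negPf -> jC] /andP[/negPf -> j'C].
    exact: nearC.
  - rewrite sumE -cats1 big_cat /= big_cons big_nil ltNge x2 addr0.
    by apply: le_trans totC; rewrite j0C' /= lerDr.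
  - rewrite sumE spread_load_rcons nlarge_rcons x2 addr0 natrD mulrDl mul1r.
    (* The loads in [C] differ by at most [e], so removing one machine raises the average by at most
       [e]; this accounts for the term [nlarge 2 s * e]. *)
    have h1 : \sum_(j in C :\ j0) load s j <= #|C :\ j0|%:R * (load s j0 + e).
      rewrite mulr_natl -sumr_const; apply: ler_sum => j.
      by rewrite !inE => /andP[_ jC]; apply: nearC.
    move: sumC; rewrite j0C' /= cE natrD mulrDl mul1r.
    have c1 : (1 <= #|C :\ j0|)%N.
      move: nlt; rewrite -[X in (_ < X)%N]cardC [(_ + true)%N]addnC ltn_add2r.
      by rewrite cE.
    have l0 : #|C :\ j0|%:R * load s j0 <= \sum_(j in C :\ j0) load s j.
      by rewrite mulr_natl -sumr_const; apply: ler_sum => j _.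
    move: h1 l0 c1; rewrite -(ler1n R) addrA.
    set c := #|_|%:R; set P := spread_load 2 s + _; set T := \sum_(i in _) _.
    move=> h1 h2 c1 h3; have c0 : 0 <= c by lra.
    rewrite -(ler_pM2l (ltr_wpDl c0 ltr01)).
    have := ler_wpM2l c0 h3; have := mulr_ge0 c0 e0.
    by have := mulr_ge0 c0 (mulr_ge0 c0 e0); lra.
have {}xe : x = e by case/orP: xe => /eqP // x2'; rewrite x2' ltxx in x2.
exists C.
have sumE : \sum_(j in C) load (rcons s x) j = \sum_(j in C) load s j + x.
  rewrite j0C' (big_setD1 j0) //= Lx eqxx addrAC; congr (_ + _ + _).
  by apply: eq_bigr => j; rewrite !inE Lx => /andP[/negPf ->].
split.
- by rewrite nlarge_rcons (leNgt 2 x) x2 addn0.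
- move=> j /[dup] jC /outC h; rewrite Lx; case: eqP => // ej.
  by rewrite ej j0C in jC.
- move=> j j' jC j'C; rewrite !Lx; case: eqP => [->|_]; case: eqP => [->|_].
  + by rewrite lerDl.
  + by rewrite xe lerD2r.
  + by apply: le_trans (nearC _ _ jC j0C) _; rewrite lerD2r lerDl.
  + exact: nearC.
- by rewrite sumE -cats1 big_cat /= big_cons big_nil x2 addr0 lerD2r.
- rewrite sumE spread_load_rcons nlarge_rcons (leNgt 2 x) x2 /= CE addn0.
  rewrite addrAC [X in _ <= X]mulrDr [_ * (x / _)]mulrCA divff ?mulr1.
    by rewrite lerD2r.
  by rewrite pnatr_eq0 -lt0n.
Qed.

Lemma greedy_loads_upper e s : 0 <= e -> e < 2 ->
    all (fun x => (x == e) || (x == 2)) s ->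
    \sum_(x <- s | x < 2) x <= 1 -> (nlarge 2 s < m)%N ->
  exists j, load s j <= spread_load 2 s + m%:R * e.
Proof.
move=> e0 e2 sE s1 nlt.
have [C [cardC outC nearC totC sumC]] := two_size_invP e0 e2 sE s1 nlt.
have [j1 j1C] : exists j, j \in C by apply/card_gt0P; lia.
have Cpos : (0 < #|C|)%N by apply/card_gt0P; exists j1.
case: (Order.TotalTheory.arg_minP (load s) j1C) => j jC jmin; exists j.
rewrite -(@ler_pM2l _ #|C|%:R) ?ltr0n //.
apply: (@le_trans _ _ (\sum_(i in C) load s i)).
  by rewrite mulr_natl -sumr_const; apply: ler_sum.
apply: le_trans sumC _.
by rewrite ler_wpM2l // lerD2l ler_wpM2r // ler_nat ltnW.
Qed.

End GreedySequence.

(** * First and second moments over random orders *)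

Section PermMean.
Variables (R : realType) (n : nat).
Implicit Types (F G : 'S_n -> R).

Definition perm_mean F : R := n`!%:R^-1 * \sum_sigma F sigma.

Lemma fact_neq0 : n`!%:R != 0 :> R.
Proof. by rewrite pnatr_eq0 -lt0n fact_gt0. Qed.

Lemma ler_perm_mean F G : (forall sigma, F sigma <= G sigma) ->
  perm_mean F <= perm_mean G.
Proof. by move=> FG; rewrite ler_wpM2l ?invr_ge0 // ler_sum. Qed.

(** Allows passing between arrival orders and position maps. *)
Lemma perm_mean_inv F : perm_mean (fun sigma => F sigma^-1%g) = perm_mean F.
Proof. by rewrite /perm_mean [in RHS](reindex_inj invg_inj). Qed.

Lemma perm_meanD F G :
  perm_mean (fun sigma => F sigma + G sigma) = perm_mean F + perm_mean G.
Proof. by rewrite /perm_mean big_split mulrDr. Qed.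

Lemma perm_meanZ c F : perm_mean (fun sigma => c * F sigma) = c * perm_mean F.
Proof. by rewrite /perm_mean -mulr_sumr mulrCA. Qed.

Lemma perm_mean_cst c : perm_mean (fun=> c) = c.
Proof.
by rewrite /perm_mean sumr_const card_Sn -[c *+ _]mulr_natl mulKf // fact_neq0.
Qed.

Lemma perm_mean_sum (I : finType) (P : pred I) (F : I -> 'S_n -> R) :
  perm_mean (fun sigma => \sum_(i | P i) F i sigma) =
  \sum_(i | P i) perm_mean (F i).
Proof. by rewrite /perm_mean exchange_big mulr_sumr. Qed.

Variables (p : 'I_n -> R) (B : {set 'I_n}) (f : nat -> R).
Let W := \sum_(x in ~: B) p x.
Let k := #|B|.
Let A1 := \sum_(i < k.+1) f i.
Let A2 := \sum_(i < k.+1) f i ^+ 2.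

(** With [B] the large jobs and [f i = 1 / (m - i)] this is the quantity phi. *)
Definition weighted_before (tau : 'S_n) : R :=
  \sum_(x in ~: B) p x * f (nbefore B tau x).

Lemma perm_mean_nbefore (g : nat -> R) x : x \notin B ->
  perm_mean (fun tau => g (nbefore B tau x)) = (\sum_(i < k.+1) g i) / k.+1%:R.
Proof.
move=> xB; apply: (@mulfI _ k.+1%:R); first by rewrite pnatr_eq0.
rewrite /perm_mean mulrCA sum_perm_nbefore // mulKf ?fact_neq0 //.
by rewrite mulrC divfK // pnatr_eq0.
Qed.

Lemma perm_mean_weighted_before : perm_mean weighted_before = W * A1 / k.+1%:R.
Proof.
rewrite perm_mean_sum -mulrA mulr_suml; apply: eq_bigr => x.
by rewrite inE => xB; rewrite perm_meanZ perm_mean_nbefore.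
Qed.

Lemma perm_mean_nbefore2 x y : x \notin B -> y \notin B -> x != y ->
  perm_mean (fun tau => f (nbefore B tau x) * f (nbefore B tau y)) =
  (A1 ^+ 2 + A2) / (k.+1%:R * k.+2%:R).
Proof.
move=> xB yB xy; have k0 : k.+1%:R * k.+2%:R != 0 :> R.
  by rewrite mulf_neq0 // pnatr_eq0.
apply: (mulfI k0); rewrite /perm_mean mulrCA sum_perm_nbefore2 //.
by rewrite mulKf ?fact_neq0 // mulrC divfK.
Qed.

Hypotheses (p_ge0 : forall x, 0 <= p x).

(** Expand the square: on the diagonal [p x ^+ 2 <= a * p x], and off the diagonal the joint law of
    two ranks applies. *)
Lemma perm_mean_weighted_before_sqr a :
    (forall x, x \notin B -> p x <= a) ->
  perm_mean (fun tau => weighted_before tau ^+ 2) <=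
  a * W * A2 / k.+1%:R + W ^+ 2 * ((A1 ^+ 2 + A2) / (k.+1%:R * k.+2%:R)).
Proof.
move=> pa; set Q := (A1 ^+ 2 + A2) / _.
have A2_ge0 : 0 <= A2 by apply: sumr_ge0 => i _; rewrite sqr_ge0.
have Q_ge0 : 0 <= Q.
  by rewrite divr_ge0 ?mulr_ge0 // addr_ge0 // sqr_ge0.
have -> : perm_mean (fun tau => weighted_before tau ^+ 2) =
  \sum_(x in ~: B) \sum_(y in ~: B) p x * p y *
    perm_mean (fun tau => f (nbefore B tau x) * f (nbefore B tau y)).
  under eq_bigr do under eq_bigr do rewrite -perm_meanZ.
  under eq_bigr do rewrite -perm_mean_sum.
  rewrite -perm_mean_sum; congr (_ * _); apply: eq_bigr => tau _.
  rewrite expr2 mulr_suml; apply: eq_bigr => x _.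
  by rewrite mulr_sumr; apply: eq_bigr => y _; rewrite mulrACA.
have -> : a * W * A2 / k.+1%:R + W ^+ 2 * Q =
    \sum_(x in ~: B) (a * p x * (A2 / k.+1%:R) + p x * W * Q).
  rewrite big_split /= -!mulr_suml -mulr_sumr -/W.
  by rewrite !mulrA expr2.
apply: ler_sum => x; rewrite inE => xB.
rewrite (bigD1 x) ?inE //=; apply: lerD.
  rewrite (_ : perm_mean _ = A2 / k.+1%:R); last first.
    rewrite -(perm_mean_nbefore (fun i => f i ^+ 2) xB).
    by congr (_ * _); apply: eq_bigr => tau _; rewrite expr2.
  by rewrite ler_wpM2r ?divr_ge0 // ler_wpM2r // pa.
(* The missing term [y = x] is nonnegative and is added to complete the sum to [W]. *)
rewrite -mulrA mulr_suml mulr_sumr [X in _ <= X](bigD1 x) ?inE //=.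
rewrite ler_wpDl ?(mulr_ge0 (p_ge0 x) (mulr_ge0 _ Q_ge0)) //; apply: ler_sum => y.
rewrite inE => /andP[yB yx].
by rewrite perm_mean_nbefore2 // ?mulrA // 1?eq_sym //.
Qed.

End PermMean.

(** * Bounds for Greedy on a given order, and for the optimum *)

Section GreedyValue.
Variables (R : realType) (m n : nat) (p : 'I_n -> R).
Hypothesis p_ge0 : forall i, 0 <= p i.

Definition job_seq (sigma : 'S_n) := [seq p (sigma t) | t <- enum 'I_n].

Definition large_jobs a := [set i | a <= p i].

Lemma size_job_seq sigma : size (job_seq sigma) = n.
Proof. by rewrite size_map size_enum_ord. Qed.

Lemma nth_job_seq sigma (t : 'I_n) : nth 0 (job_seq sigma) t = p (sigma t).
Proof. by rewrite (nth_map t) ?size_enum_ord // nth_ord_enum. Qed.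

Lemma nlarge_take_job_seq a sigma t : (t <= n)%N ->
  nlarge a (take t (job_seq sigma)) =
  #|[set u : 'I_n | (a <= p (sigma u)) && (u < t)%N]|.
Proof.
move=> tn; rewrite /nlarge -sum1_count (big_nth 0) size_takel ?size_job_seq //.
rewrite big_mkord.
rewrite (big_ord_widen_cond n (fun i => a <= nth 0 (take t (job_seq sigma)) i)
  (fun=> 1%N)) //.
rewrite -sum1_card; apply: eq_bigl => u; rewrite inE.
have [ut|] := ltnP u t; last by rewrite !andbF.
by rewrite nth_take // nth_job_seq.
Qed.

Lemma nlarge_job_seq a sigma : nlarge a (job_seq sigma) = #|large_jobs a|.
Proof.
rewrite -[job_seq _]take_size size_job_seq nlarge_take_job_seq //.
rewrite -(card_imset _ (@perm_inj _ sigma)); apply: eq_card => x.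
apply/imsetP/idP => [[u]|]; rewrite !inE; first by case/andP => ? _ ->.
by move=> ax; exists (sigma^-1 x)%g; rewrite ?inE permKV // ax ltn_ord.
Qed.

Lemma spread_load_job_seq a sigma :
  spread_load m a (job_seq sigma) =
  weighted_before p (large_jobs a) (fun i => (m - i)%:R^-1) sigma^-1%g.
Proof.
rewrite /spread_load
  -(big_mkord (fun t => nth 0 (job_seq sigma) t < a)
     (fun t => nth 0 (job_seq sigma) t /
        (m - nlarge a (take t (job_seq sigma)))%:R)).
rewrite size_job_seq big_mkord /weighted_before.
rewrite [RHS](reindex_inj (@perm_inj _ sigma)) /=.
apply: eq_big => [t|t _]; first by rewrite nth_job_seq !inE ltNge.
rewrite nth_job_seq nlarge_take_job_seq 1?ltnW //; congr (_ / (m - _)%:R).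
rewrite /nbefore -[LHS](card_imset _ (@perm_inj _ sigma)); apply: eq_card => x.
apply/imsetP/idP => [[u]|]; rewrite !inE.
  by case/andP=> au ut ->; rewrite au !permK.
case/andP=> ax; rewrite permK => xt.
by exists (sigma^-1 x)%g; rewrite ?inE permKV // ax xt.
Qed.

Lemma le_min_load ub (L : 'I_m -> R) v :
  v <= ub -> (forall j, v <= L j) -> v <= min_load ub L.
Proof. by move=> vub vL; apply: le_bigmin. Qed.

Lemma min_load_le ub (L : 'I_m -> R) j : min_load ub L <= L j.
Proof. exact: bigmin_le. Qed.

Lemma min_load_le_ub ub (L : 'I_m -> R) : min_load ub L <= ub.
Proof. exact: bigmin_le_id. Qed.

Variable tb : seq R -> ('I_m -> R) -> 'I_m.
Hypothesis tb_valid : valid_tiebreak tb.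

(** The bound on [a] by the total is there because [min_load] is capped by its neutral element. *)
Lemma greedy_val_lower a sigma : 0 <= a -> a <= Defs.total p ->
  a <= greedy_val tb p sigma \/
  (#|large_jobs a| < m)%N /\
  Order.min a (spread_load m a (job_seq sigma) - a) <= greedy_val tb p sigma.
Proof.
move=> a0 atot.
have s0 : all (fun x => 0 <= x) (job_seq sigma).
  by apply/allP => x /mapP[t _ ->].
have [aL|[lm aL]] := greedy_loads_lower tb_valid a0 s0.
  by left; apply: le_min_load.
right; rewrite -(nlarge_job_seq a sigma); split => //.
apply: le_min_load => [|j]; first by rewrite ge_min atot.
by rewrite ge_min lerBlDr aL orbT.
Qed.

Lemma OPT_ge0 : 0 <= OPT m p.
Proof. exact: bigmax_ge_id. Qed.

Lemma OPT_le v : 0 <= v ->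
  (forall f : {ffun 'I_n -> 'I_m},
    min_load (Defs.total p) (fun j => \sum_(i < n | f i == j) p i) <= v) ->
  OPT m p <= v.
Proof. by move=> v0 H; apply: bigmax_le. Qed.

Lemma OPT_le_total : OPT m p <= Defs.total p.
Proof.
apply: OPT_le => [|f]; first exact: sumr_ge0.
exact: min_load_le_ub.
Qed.

(* In any schedule at least m - k machines receive no large job. *)
Lemma OPT_le_small a : (#|large_jobs a| < m)%N ->
  (m - #|large_jobs a|)%:R * OPT m p <= \sum_(x in ~: large_jobs a) p x.
Proof.
set B := large_jobs a => km; set W := \sum_(x in _) _.
have W0 : 0 <= W by exact: sumr_ge0.
have d0 : 0 < (m - #|B|)%:R :> R by rewrite ltr0n subn_gt0.
rewrite mulrC -ler_pdivlMr //; apply: OPT_le => [|f].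
  by rewrite divr_ge0 // ltW.
rewrite ler_pdivlMr //; set v := min_load _ _.
have v0 : 0 <= v by apply: le_min_load => [|j]; apply: sumr_ge0.
pose C := ~: (f @: B).
have cC : (m - #|B| <= #|C|)%N.
  have := cardsC (f @: B); rewrite card_ord -/C => cE.
  by rewrite leq_subLR -[X in (X <= _)%N]cE leq_add2r leq_imset_card.
apply: (@le_trans _ _ (#|C|%:R * v)).
  by rewrite mulrC ler_wpM2r // ler_nat.
rewrite mulr_natl -sumr_const.
apply: (@le_trans _ _ (\sum_(j in C) \sum_(i < n | f i == j) p i)).
  by apply: ler_sum => j _; apply: min_load_le.
rewrite (exchange_big_dep (fun i => f i \in C)) /=; last first.
  by move=> j i jC /eqP ->.
rewrite [X in X <= _](_ : _ = \sum_(i | f i \in C) p i); last first.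
  apply: eq_bigr => i fiC; rewrite (big_pred1 (f i)) // => j /=.
  by rewrite [f i == j]eq_sym; case: eqP => [->|]; rewrite ?fiC ?andbF.
(* Every job that [f] puts on a machine of [C] is small, so these jobs are part of the sum [W]. *)
rewrite [X in _ <= X](bigID (fun i => f i \in C)) /= ler_wpDr ?sumr_ge0 //.
rewrite le_eqVlt; apply/orP; left; apply/eqP; apply: eq_bigl => i.
apply/idP/andP => [fiC|[]//]; split => //; rewrite inE; move: fiC.
by rewrite inE; apply: contraNN => iB; rewrite imset_f.
Qed.

End GreedyValue.

(** * Estimates for harmonic sums *)

Section Harmonic.
Variable R : realType.
Implicit Types m n k : nat.
Let H : nat -> R := @harmonic_number R.

Lemma harmonicS n : H n.+1 = H n + n.+1%:R^-1.
Proof. by rewrite /H /harmonic_number big_ord_recr. Qed.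

Lemma harmonic_ge1 n : (0 < n)%N -> 1 <= H n.
Proof.
case: n => // n _; elim: n => [|n IH]; rewrite harmonicS.
  by rewrite /H /harmonic_number big_ord0 add0r invr1.
by rewrite (le_trans IH) // lerDl invr_ge0.
Qed.

Lemma harmonic_le n : H n <= n%:R.
Proof.
elim: n => [|n IH]; first by rewrite /H /harmonic_number big_ord0.
by rewrite harmonicS -[X in _ <= X]natr1 lerD // invf_le1 ?ltr0n ?ler1n.
Qed.

(** Used to show that [H d] is at most half of [H m] when [d < H m] and [H m >= 16]. With
    [u ^+ 2 = v ^+ 2 + 1] the step needs [1 / u ^+ 2 <= 2 * (u - v)], which follows from
    [(u - v) * (u + v) = 1] and [u >= 1]. *)
Lemma harmonic_le_sqrt n : H n <= 2 * Num.sqrt n%:R.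
Proof.
elim: n => [|n IH].
  by rewrite /H /harmonic_number big_ord0 mulr_ge0 // sqrtr_ge0.
rewrite harmonicS; apply: (le_trans (lerD IH (lexx _))).
set u := Num.sqrt n.+1%:R; set v := Num.sqrt n%:R.
have u2 : n.+1%:R = u ^+ 2 by rewrite sqr_sqrtr.
have v2 : n%:R = v ^+ 2 by rewrite sqr_sqrtr.
have v0 : 0 <= v by exact: sqrtr_ge0.
have u1 : 1 <= u by rewrite -[1]sqrtr1 ler_wsqrtr // ler1n.
have uv : u ^+ 2 = v ^+ 2 + 1 by rewrite -u2 -v2 natr1.
rewrite u2 -lerBrDl -mulrBr -[u ^- 2]div1r ler_pdivrMr ?exprn_gt0 //; last lra.
have vu : v <= u by rewrite -ler_sqr ?nnegrE //; lra.
have : 1 <= (u - v) * (2 * u) by nra.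
have : 0 <= (u - v) * (2 * u) * (u - 1) by rewrite !mulr_ge0 //; lra.
lra.
Qed.

Lemma harmonic_ge_ln n : ln n.+1%:R <= H n.
Proof.
elim: n => [|n IH]; first by rewrite ln1 /H /harmonic_number big_ord0.
rewrite harmonicS.
have -> : n.+2%:R = n.+1%:R * (1 + n.+1%:R^-1) :> R.
  by rewrite mulrDr mulr1 divff ?pnatr_eq0 // natr1.
have i0 : 0 < n.+1%:R^-1 :> R by rewrite invr_gt0 ltr0n.
rewrite lnM ?posrE ?ltr0n ?addr_gt0 // lerD // le_ln1Dx //.
by rewrite (lt_trans _ i0) // ltrN10.
Qed.

Lemma harmonic_le_ln n : (0 < n)%N -> H n <= 1 + ln n%:R.
Proof.
case: n => // n _; elim: n => [|n IH].
  by rewrite ln1 /H /harmonic_number big_ord1 invr1 addr0.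
rewrite harmonicS; apply: (le_trans (lerD IH (lexx _))).
rewrite -addrA lerD2l -lerBrDl.
have i0 : 0 < n.+2%:R^-1 :> R by rewrite invr_gt0 ltr0n.
have i1 : n.+2%:R^-1 < 1 :> R by rewrite invf_lt1 ?ltr0n // ltr1n.
have := @le_ln1Dx R (- n.+2%:R^-1); rewrite ltrN2 => /(_ i1).
have -> : 1 - n.+2%:R^-1 = n.+1%:R / n.+2%:R :> R.
  apply: (@mulIf _ n.+2%:R); first by rewrite pnatr_eq0.
  by rewrite divfK ?pnatr_eq0 // mulrBl mulVf ?pnatr_eq0 // mul1r -natr1 addrK.
by rewrite lnM ?posrE ?ltr0n // lnV ?posrE ?ltr0n // -[in X in _ -> X]lerN2 opprB.
Qed.

(** The numbers 1..m split into the top [k], listed downwards, and the lower [m - k]. *)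
Lemma sum_rev_split (g : nat -> R) m k : (k <= m)%N ->
  \sum_(i < k) g (m - i)%N + \sum_(i < m - k) g i.+1 = \sum_(i < m) g i.+1.
Proof.
elim: k => [|k IH] km; first by rewrite big_ord0 add0r subn0.
rewrite -(IH (ltnW km)) big_ord_recr /= -subSS subSn // big_ord_recr /=.
by rewrite -!addrA; congr (_ + _); rewrite addrC.
Qed.

(** The subtracted inverse makes the induction telescope; at [n = 0] it is 0 by convention. *)
Lemma sum_inv_sqr_le n : \sum_(i < n) i.+1%:R^-1 ^+ 2 <= 2 - n%:R^-1 :> R.
Proof.
case: n => [|n]; first by rewrite big_ord0 invr0 subr0.
elim: n => [|n IH]; first by rewrite big_ord1 invr1 expr1n; lra.
rewrite big_ord_recr /=; apply: (le_trans (lerD IH (lexx _))).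
have n0 : 0 < n.+1%:R :> R by rewrite ltr0n.
rewrite -[n.+2%:R]natr1; set u : R := n.+1%:R.
have v0 : 0 < u + 1 by rewrite addr_gt0.
have -> : u^-1 = (u + 1)^-1 + u^-1 * (u + 1)^-1.
  by field; rewrite !gt_eqF.
have : (u + 1)^-1 <= u^-1 by rewrite lef_pV2 ?posrE // lerDl.
move=> h; have := ler_wpM2r (ltW (_ : 0 < (u + 1)^-1)) h.
rewrite invr_gt0 => /(_ v0); move: ((u + 1)^-1) (u^-1) => y w; lra.
Qed.

Lemma sum_inv_sub m k : (k <= m)%N ->
  \sum_(i < k) (m - i)%:R^-1 = H m - H (m - k).
Proof.
move=> km; rewrite {1}/H /harmonic_number.
by rewrite -(sum_rev_split (fun i => i%:R^-1) km) addrK.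
Qed.

Lemma sum_inv_sub_sqr m k : (k <= m)%N ->
  \sum_(i < k) (m - i)%:R^-1 ^+ 2 <= 2 :> R.
Proof.
move=> km; apply: (@le_trans _ _ (2 - m%:R^-1)); last first.
  by rewrite lerBlDr lerDl invr_ge0.
apply: le_trans (sum_inv_sqr_le m).
rewrite -(sum_rev_split (fun i => i%:R^-1 ^+ 2) km) lerDl.
by apply: sumr_ge0 => i _; rewrite sqr_ge0.
Qed.

End Harmonic.

(** * Upper bound on the competitive ratio *)

Section UpperBound.
Variables (R : realType) (m n : nat) (p : 'I_n -> R).
Hypothesis p_ge0 : forall i, 0 <= p i.
Variable tb : seq R -> ('I_m -> R) -> 'I_m.
Hypotheses (tb_valid : valid_tiebreak tb) (m_gt0 : (0 < m)%N).

Let H := harmonic_number R m.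
Let small_total a := \sum_(x in ~: large_jobs p a) p x.
Let inv_free i : R := (m - i)%:R^-1.

Lemma weighted_before_ge a tau : (#|large_jobs p a| < m)%N ->
  small_total a / m%:R <= weighted_before p (large_jobs p a) inv_free tau.
Proof.
move=> km; rewrite mulr_suml; apply: ler_sum => x _; rewrite ler_wpM2l //.
have km' := leq_ltn_trans (nbefore_le (large_jobs p a) tau x) km.
by rewrite lef_pV2 ?posrE ?ltr0n ?subn_gt0 // ler_nat leq_subr.
Qed.

(** Here [a] is reached on every order: phi is surely at least the small total over [m], and with
    [m] or more large jobs all loads reach [a] anyway. *)
Lemma greedy_rom_ge a : 0 <= a -> a <= Defs.total p ->
    ((#|large_jobs p a| < m)%N -> 2 * a <= small_total a / m%:R) ->
  a <= greedy_rom tb p.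
Proof.
move=> a0 atot aW; rewrite -[a](@perm_mean_cst R n).
apply: ler_perm_mean => sigma.
have [//|[km]] := greedy_val_lower p_ge0 tb_valid sigma a0 atot.
apply: le_trans; rewrite le_min lexx /= spread_load_job_seq.
by have := weighted_before_ge sigma^-1%g km; have := aW km; lra.
Qed.

(** This crude bound serves when [H] is small, and shows that the ratio has a nonzero denominator in
    the lower bound. *)
Lemma greedy_rom_ge_OPT : OPT m p / (2 * m%:R) <= greedy_rom tb p.
Proof.
have m0 : 0 < m%:R :> R by rewrite ltr0n.
have m1 : 1 <= m%:R :> R by rewrite ler1n.
have O0 := OPT_ge0 m p.
apply: greedy_rom_ge => [||km].
- by rewrite divr_ge0 // mulr_ge0.
- apply: le_trans (OPT_le_total m p_ge0).
  rewrite ler_pdivrMr ?mulr_gt0 // ler_peMr //; lra.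
- have := OPT_le_small p_ge0 km.
  have -> : 2 * (OPT m p / (2 * m%:R)) = OPT m p / m%:R.
    by field; rewrite gt_eqF.
  move=> h; rewrite ler_pM2r ?invr_gt0 //; apply: le_trans h.
  by rewrite ler_peMl // ler1n subn_gt0.
Qed.

(** Since [(m - k) * OPT] is at most the small total, the last hypothesis forces [m - k < H]. Then
    [A1], the part of the harmonic sum that phi sees, is at least [H / 2], while [A2] is at most
    2. *)
Lemma perm_mean_sqr_dev a : (#|large_jobs p a| < m)%N ->
    16 <= H -> 0 < OPT m p -> a = H / (2 * m%:R) * OPT m p ->
    small_total a < H * OPT m p ->
  let mu := perm_mean (weighted_before p (large_jobs p a) inv_free) in
  2 * a <= mu /\
  perm_mean (fun tau =>
    weighted_before p (large_jobs p a) inv_free tau ^+ 2) <=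
  (1 + 5 / H) * mu ^+ 2.
Proof.
set B := large_jobs p a; set v := OPT m p => km H16 v0 aE WH mu.
have m0 : 0 < m%:R :> R by rewrite ltr0n.
have H0 : 0 < H by lra.
have pa x : x \notin B -> p x <= a by rewrite inE -ltNge => /ltW.
have sq := perm_mean_weighted_before_sqr inv_free p_ge0 pa.
have muE := perm_mean_weighted_before p B inv_free.
rewrite -/mu in muE.
have := OPT_le_small p_ge0 km; rewrite -/B -/v => WD.
move: muE sq WD WH; rewrite /small_total -/B; set W := \sum_(x in _) _.
set A1 := \sum_(i < _) _; set A2 := \sum_(i < _) _.
set k := #|B| in km A1 A2 * => muE sq WD WH.
have D1 : 1 <= (m - k)%:R :> R by rewrite ler1n subn_gt0.
have Wv : v <= W by apply: le_trans WD; rewrite ler_peMl // ltW.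
have W0 : 0 < W by lra.
have A1E : A1 = H - harmonic_number R (m - k.+1) by rewrite /A1 sum_inv_sub.
have A22 : A2 <= 2 by apply: sum_inv_sub_sqr.
have A20 : 0 <= A2 by apply: sumr_ge0 => i _; rewrite sqr_ge0.
have DH : (m - k)%:R < H by rewrite -(ltr_pM2r v0); lra.
have hD : harmonic_number R (m - k.+1) <= H / 2.
  apply: le_trans (harmonic_le_sqrt R _) _.
  have H4 : 4 <= Num.sqrt H.
    by rewrite -[4]gtr0_norm // -sqrtr_sqr ler_wsqrtr //; lra.
  have HH : Num.sqrt H ^+ 2 = H by rewrite sqr_sqrtr // ltW.
  have : Num.sqrt (m - k.+1)%:R <= Num.sqrt H.
    rewrite ler_wsqrtr //; apply: ltW; apply: le_lt_trans DH.
    by rewrite ler_nat leq_sub2l.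
  by nra.
have A1H : H / 2 <= A1 by lra.
(* If [m - k = 1], then [A1] is all of [H]; otherwise [m - k >= 2] makes up for the factor 1/2. *)
have DA : H <= (m - k)%:R * A1.
  have [D|D] := leqP (m - k)%N 1.
    have Dk : (m - k = 1)%N by apply/eqP; rewrite eqn_leq D subn_gt0.
    have -> : A1 = H.
      rewrite A1E subnS Dk.
      by rewrite /harmonic_number big_ord0 subr0.
    by rewrite Dk mul1r.
  have D2 : 2 <= (m - k)%:R :> R by rewrite ler_nat.
  have : 2 * A1 <= (m - k)%:R * A1 by rewrite ler_wpM2r //; lra.
  by lra.
set K : R := k.+1%:R in muE sq.
have K0 : 0 < K by rewrite ltr0n.
have Km : K <= m%:R by rewrite ler_nat.
have am : a * m%:R = H * v / 2.
  by rewrite aE invfM; field; rewrite gt_eqF.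
have a0 : 0 <= a by rewrite aE mulr_ge0 ?divr_ge0 ?mulr_ge0 // ltW.
split.
  rewrite muE ler_pdivlMr //.
  have h1 : 2 * a * K <= 2 * a * m%:R by rewrite ler_wpM2l // mulr_ge0.
  have h2 : v * H <= v * ((m - k)%:R * A1) by rewrite ler_wpM2l // ltW.
  have h3 : (m - k)%:R * v * A1 <= W * A1 by rewrite ler_wpM2r //; lra.
  by lra.
apply: (le_trans sq); rewrite muE.
(* Replacing [k + 2] by [k + 1] makes the [A1] part equal to the squared mean. *)
have KK : W ^+ 2 * ((A1 ^+ 2 + A2) / (K * k.+2%:R)) <=
          W ^+ 2 * ((A1 ^+ 2 + A2) / K ^+ 2).
  rewrite ler_wpM2l ?sqr_ge0 // ler_wpM2l ?addr_ge0 ?sqr_ge0 //.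
  rewrite lef_pV2 ?posrE ?mulr_gt0 ?exprn_gt0 ?ltr0n // expr2 ler_wpM2l //.
  by rewrite ler_nat.
apply: (le_trans (lerD (lexx _) KK)).
rewrite -(ler_pM2r (exprn_gt0 2 K0)).
have -> : (a * W * A2 / K + W ^+ 2 * ((A1 ^+ 2 + A2) / K ^+ 2)) * K ^+ 2 =
          W * (a * K * A2 + W * A2) + (W * A1) ^+ 2.
  by field; rewrite gt_eqF.
have -> : (1 + 5 / H) * (W * A1 / K) ^+ 2 * K ^+ 2 =
          W * (5 * W * (A1 ^+ 2 / H)) + (W * A1) ^+ 2.
  by field; rewrite !gt_eqF.
rewrite lerD2r ler_wpM2l //; first exact: ltW.
have AH : H / 4 <= A1 ^+ 2 / H.
  rewrite ler_pdivlMr // (_ : H / 4 * H = (H / 2) ^+ 2); last by field.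
  by rewrite ler_sqr ?nnegrE //; lra.
have aK : a * K <= H * W / 2.
  have : a * K <= a * m%:R by rewrite ler_wpM2l.
  have : H * v <= H * W by rewrite ler_wpM2l // ltW.
  by lra.
(* Origin of the 5: this is at most [H * W + 2 * W], the other side is at least [5 * H * W / 4], and
   [H >= 16]. *)
have : a * K * A2 + W * A2 <= (H * W / 2 + W) * 2.
  rewrite -mulrDl ler_pM ?addr_ge0 ?mulr_ge0 //; try lra; exact: ltW.
have : W * (H / 4) <= W * (A1 ^+ 2 / H) by rewrite ler_wpM2l // ltW.
have : W * 16 <= W * H by rewrite ler_wpM2l // ltW.
lra.
Qed.

(** In place of a tail bound, [min (a, phi - a)] is bounded below by a quadratic in phi, whose mean
    the two moments control. *)
Lemma greedy_rom_ge_harmonic : 16 <= H ->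
  H / (2 * m%:R) * OPT m p * (1 - 2 * Num.sqrt (5 / H)) <= greedy_rom tb p.
Proof.
move=> H16; set v := OPT m p; set a := _ * v; set q := Num.sqrt _.
have m0 : 0 < m%:R :> R by rewrite ltr0n.
have H0 : 0 < H by lra.
have v0 : 0 <= v := OPT_ge0 m p.
have q0 : 0 < q by rewrite sqrtr_gt0 divr_gt0.
have q2 : q ^+ 2 = 5 / H by rewrite sqr_sqrtr // divr_ge0 // ltW.
have a0 : 0 <= a by rewrite mulr_ge0 // divr_ge0 ?mulr_ge0 // ltW.
have atot : a <= Defs.total p.
  apply: le_trans (OPT_le_total m p_ge0); rewrite /a -/v ler_piMl //.
  rewrite ler_pdivrMr ?mulr_gt0 // mul1r.
  by have := harmonic_le R m; rewrite -/H; lra.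
have [mk|km] := leqP m #|large_jobs p a|.
  apply: (@le_trans _ _ a); first by rewrite ler_piMr //; lra.
  by apply: greedy_rom_ge => //; rewrite ltnNge mk.
(* With this many small jobs phi is at least [2 * a] on every order. *)
have [WH|WH] := leP (H * v) (small_total a).
  apply: (@le_trans _ _ a); first by rewrite ler_piMr //; lra.
  apply: greedy_rom_ge => // _; rewrite ler_pdivlMr //.
  suff -> : 2 * a * m%:R = H * v by [].
  by rewrite /a; field; rewrite gt_eqF.
have {v0} v0 : 0 < v.
  rewrite lt_neqAle v0 andbT; apply: contraTneq WH => <-.
  by rewrite mulr0 -leNgt sumr_ge0.
have [] := perm_mean_sqr_dev km H16 v0 erefl WH.
set X := weighted_before _ _ _; set mu := perm_mean X => amu sq.
have a1 : 0 < a by rewrite mulr_gt0 // divr_gt0 // mulr_gt0.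
have mu0 : 0 < mu by lra.
have q0' := ltW q0.
have aq : 0 <= a * q by rewrite mulr_ge0.
have zq y : 0 <= a / q * y ^+ 2 := mulr_ge0 (divr_ge0 a0 q0') (sqr_ge0 y).
(* [F] is the quadratic [a - a q - (a / q) (1 - X / mu)^2]. The mean of the square is at most
   [q ^+ 2], so [F] has mean at least [a (1 - 2 q)]. *)
pose c0 := a - a * q - a / q.
pose F tau := c0 + (2 * (a / q) / mu * X tau
   + - (a / q / mu ^+ 2) * X tau ^+ 2).
have FE tau : F tau = a - a * q - a / q * (1 - X tau / mu) ^+ 2.
  by rewrite /F /c0; field; rewrite !gt_eqF.
apply: (@le_trans _ _ (perm_mean F)).
  rewrite (perm_meanD (fun=> c0)) (perm_meanD (fun tau => _ * X tau)).
  rewrite (perm_mean_cst _ c0) !perm_meanZ -/mu mulfVK ?gt_eqF // /c0.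
  have : a / q / mu ^+ 2 * perm_mean (fun tau => X tau ^+ 2) <= a / q * (1 + q ^+ 2).
    rewrite -[X in X <= _]mulrA ler_wpM2l ?divr_ge0 //.
    by rewrite mulrC ler_pdivrMr ?exprn_gt0 // q2.
  have -> : a / q * (1 + q ^+ 2) = a / q + a * q by field; rewrite gt_eqF.
  lra.
rewrite -[X in X <= _]perm_mean_inv; apply: ler_perm_mean => sigma.
have [gv|[_]] := greedy_val_lower p_ge0 tb_valid sigma a0 atot.
  apply: le_trans gv; rewrite FE -addrA -opprD lerBlDr lerDl.
  by rewrite addr_ge0.
apply: le_trans; rewrite FE spread_load_job_seq -/X.
set x := X _; set z := 1 - x / mu.
have x0 : 0 <= x.
  apply: le_trans (weighted_before_ge _ km).
  by rewrite divr_ge0 // sumr_ge0.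
rewrite le_min; apply/andP; split; first by have := zq z; lra.
(* AM-GM: 2 z <= q + z^2 / q *)
have h1 : 2 * a * z <= a * q + a / q * z ^+ 2.
  have -> : a * q + a / q * z ^+ 2 = 2 * a * z + a / q * (z - q) ^+ 2.
    by field; rewrite gt_eqF.
  by rewrite lerDl.
have h2 : 2 * a * (x / mu) <= x.
  by rewrite mulrA ler_pdivrMr // mulrC ler_wpM2l.
move: h1; rewrite /z mulrBr mulr1; lra.
Qed.

End UpperBound.

(** * The instance for the lower bound *)

Section LowerBound.
Variables (R : realType) (M N : nat).
Hypothesis N_gt0 : (0 < N)%N.

Definition two_size_jobs (i : 'I_(M + N)) : R :=
  if (i < M)%N then 2 else N%:R^-1.
Let p := two_size_jobs.

Let e_ge0 : 0 <= N%:R^-1 :> R. Proof. by rewrite invr_ge0. Qed.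

Let e_lt2 : N%:R^-1 < 2 :> R.
Proof.
by rewrite (@le_lt_trans _ _ 1) ?ltr1n // invf_le1 ?ltr0n // ler1n.
Qed.

Let pl (i : 'I_M) : p (lshift N i) = 2.
Proof. by rewrite /p /two_size_jobs /= ltn_ord. Qed.

Let pr (i : 'I_N) : p (rshift M i) = N%:R^-1.
Proof. by rewrite /p /two_size_jobs /= ltnNge leq_addr. Qed.

Let sum_e : \sum_(i < N) N%:R^-1 = 1 :> R.
Proof.
by rewrite sumr_const card_ord -[_ *+ N]mulr_natl mulfV // pnatr_eq0 -lt0n.
Qed.

Lemma two_size_jobs_ge0 i : 0 <= p i.
Proof. by rewrite /p /two_size_jobs; case: ifP. Qed.

Lemma card_large_two_size : #|large_jobs p 2| = M.
Proof.
rewrite -sum1_card big_mkcond big_split_ord /=.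
rewrite [X in (X + _)%N](eq_bigr (fun=> 1%N)); last first.
  by move=> i _; rewrite inE pl lexx.
rewrite [X in (_ + X)%N]big1 => [|i _]; last by rewrite inE pr leNgt e_lt2.
by rewrite sum1_card card_ord addn0.
Qed.

Lemma small_two_size : \sum_(x in ~: large_jobs p 2) p x = 1.
Proof.
rewrite big_mkcond big_split_ord /= big1 ?add0r => [|i _]; last first.
  by rewrite !inE pl lexx.
by rewrite -[RHS]sum_e; apply: eq_bigr => i _; rewrite !inE pr leNgt e_lt2.
Qed.

Lemma OPT_two_size : 1 <= OPT M.+1 p.
Proof.
(* Each large job gets its own machine, and all tiny jobs go to the last one. *)
pose f := [ffun i : 'I_(M + N) => inord (minn i M) : 'I_M.+1].
apply: le_trans (le_bigmax _ _ f); apply: le_min_load => [|j].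
  rewrite /Defs.total big_split_ord /=.
  rewrite [X in _ <= _ + X](_ : _ = 1); last first.
    by rewrite -[RHS]sum_e; apply: eq_bigr => i _; rewrite pr.
  by rewrite lerDr sumr_ge0 // => i _; apply: two_size_jobs_ge0.
have [jM|jM] := ltnP j M.
  rewrite (bigD1 (lshift N (Ordinal jM))) /=; last first.
    rewrite ffunE /= (minn_idPl (ltnW jM)); apply/eqP/val_inj.
    by rewrite /= inordK // ltnS ltnW.
  rewrite pl ler_wpDr ?ler1n ?sumr_ge0 // => i _; exact: two_size_jobs_ge0.
have {jM} jM : j = M :> nat by apply/eqP; rewrite eqn_leq jM -ltnS ltn_ord.
rewrite big_mkcond big_split_ord /= -[X in X <= _]sum_e ler_wpDl //.
  by apply: sumr_ge0 => i _; case: ifP => // _; apply: two_size_jobs_ge0.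
apply: ler_sum => i _; rewrite ffunE /= (minn_idPr (leq_addr _ _)) ifT ?pr //.
by apply/eqP/val_inj; rewrite /= inordK // jM.
Qed.

Variable tb : seq R -> ('I_M.+1 -> R) -> 'I_M.+1.
Hypothesis tb_valid : valid_tiebreak tb.

(** With [M] large jobs on [M.+1] machines the sum of the [f i] is the full harmonic number; the
    last term is the accumulated granularity of the tiny jobs. *)
Lemma greedy_rom_two_size :
  greedy_rom tb p <= harmonic_number R M.+1 / M.+1%:R + M.+1%:R / N%:R.
Proof.
pose f i : R := (M.+1 - i)%:R^-1.
have <- : perm_mean (fun tau =>
    weighted_before p (large_jobs p 2) f tau + M.+1%:R / N%:R) =
    harmonic_number R M.+1 / M.+1%:R + M.+1%:R / N%:R.
  rewrite perm_meanD perm_mean_cst perm_mean_weighted_before small_two_size.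
  rewrite card_large_two_size mul1r; congr (_ / _ + _).
  by rewrite sum_inv_sub // subnn /harmonic_number big_ord0 subr0.
rewrite -[X in _ <= X]perm_mean_inv; apply: ler_perm_mean => sigma.
rewrite -spread_load_job_seq.
have sE : all (fun x => (x == N%:R^-1) || (x == 2)) (job_seq p sigma).
  apply/allP => x /mapP[t _ ->]; rewrite /p /two_size_jobs.
  by case: ifP; rewrite eqxx ?orbT.
have s1 : \sum_(x <- job_seq p sigma | x < 2) x <= 1.
  rewrite big_map big_enum_cond -[X in _ <= X]small_two_size.
  rewrite [X in _ <= X](reindex_inj (@perm_inj _ sigma)) /=.
  rewrite le_eqVlt; apply/orP; left; apply/eqP; apply: eq_bigl => t.
  by rewrite !inE ltNge.
have nM : (nlarge 2 (job_seq p sigma) < M.+1)%N.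
  by rewrite nlarge_job_seq card_large_two_size.
have [j jL] := greedy_loads_upper tb_valid e_ge0 e_lt2 sE s1 nM.
exact: le_trans (min_load_le _ _ j) jL.
Qed.

End LowerBound.

(** * From values to competitive ratios and asymptotics *)

Section CompetitiveRatio.
Variable R : realType.
Let H : nat -> R := @harmonic_number R.

(** If [b = 0], then [a = 0] and the ratio is 1 by convention, whence [1 <= c]. *)
Lemma ratio_le (a b c : R) : 0 <= a -> 0 <= b -> 1 <= c -> a <= c * b ->
  (Defs.ratio a b <= c%:E)%E.
Proof.
move=> a0 b0 c1; rewrite /Defs.ratio; case: eqVneq => [->|bN0] acb.
  by rewrite ifT ?lee_fin // eq_le a0 -(mulr0 c) acb.
by rewrite lee_fin ler_pdivrMr // lt_neqAle eq_sym bN0.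
Qed.

(** Below 80 the crude factor [2 * m] suffices. From 80 on, [q = sqrt (5 / H)] is at most 1/4, which
    gives [2 / (1 - 2 q) <= 2 + 8 q]. *)
Definition upper_eps (m : nat) : R :=
  if H m < 80 then 2 * H m else 8 * Num.sqrt (5 / H m).

Lemma sqrt_5_div_le (h : R) : 80 <= h -> Num.sqrt (5 / h) <= 1 / 4.
Proof.
move=> h80; have h0 : 0 < h by lra.
rewrite -[1 / 4]gtr0_norm -?sqrtr_sqr ?ler_wsqrtr //.
by rewrite ler_pdivrMr //; lra.
Qed.

Lemma upper_eps_bounds m : (0 < m)%N -> 0 <= upper_eps m <= 160.
Proof.
move=> m0; have H1 := harmonic_ge1 R m0; rewrite -/(H m) in H1.
rewrite /upper_eps; case: ltP => h; first by apply/andP; split; lra.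
have := sqrt_5_div_le h; have := sqrtr_ge0 (5 / H m).
by move=> ? ?; apply/andP; split; lra.
Qed.

Lemma greedy_cr_le m (tb : seq R -> ('I_m -> R) -> 'I_m) :
  (0 < m)%N -> valid_tiebreak tb ->
  (greedy_cr tb <= ((2 + upper_eps m) * m%:R / H m)%:E)%E.
Proof.
move=> m0 tb_valid; apply: ge_ereal_sup => _ [n [p [p0 ->]]].
have H1 : 1 <= H m by exact: harmonic_ge1.
have Hm : H m <= m%:R by exact: harmonic_le.
have H0 : 0 < H m by lra.
have mR : 0 < m%:R :> R by rewrite ltr0n.
have /andP[e0 _] := upper_eps_bounds m0.
have O0 := OPT_ge0 m p.
have simple := greedy_rom_ge_OPT p0 tb_valid m0.
have rom0 : 0 <= greedy_rom tb p.
  by apply: le_trans simple; rewrite divr_ge0 // mulr_ge0.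
apply: ratio_le => //.
  rewrite ler_pdivlMr // mul1r (le_trans Hm) // ler_peMl ?ler0n //; lra.
rewrite /upper_eps; case: ltP => h80.
  move: simple; rewrite ler_pdivrMr ?mulr_gt0 // => simple.
  apply: (le_trans simple).
  rewrite (_ : _ / H m * _ =
    greedy_rom tb p * (2 * m%:R) + greedy_rom tb p * (2 * m%:R / H m)).
    by rewrite lerDl mulr_ge0 // divr_ge0 ?mulr_ge0 // ltW.
  by field; rewrite gt_eqF.
have h16 : 16 <= H m by lra.
have := greedy_rom_ge_harmonic p0 tb_valid m0 h16.
rewrite -/(H m); set q := Num.sqrt _ => main.
have q4 : q <= 1 / 4 by exact: sqrt_5_div_le.
have q0 : 0 <= q by exact: sqrtr_ge0.
have c0 : 0 <= (2 + 8 * q) * m%:R / H m.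
  by rewrite divr_ge0 ?mulr_ge0 //; lra.
apply: le_trans (ler_wpM2l c0 main).
rewrite [X in _ <= X](_ : _ = OPT m p + OPT m p * (2 * q * (1 - 4 * q))).
  by rewrite lerDl mulr_ge0 // mulr_ge0 //; lra.
by field; rewrite !gt_eqF.
Qed.

Lemma greedy_cr_ge m (tb : seq R -> ('I_m -> R) -> 'I_m) :
  (0 < m)%N -> valid_tiebreak tb ->
  (((1 - m%:R^-1) * m%:R / H m)%:E <= greedy_cr tb)%E.
Proof.
(* With [m ^ 3] tiny jobs the error [m / N] is [1 / m ^ 2], which is at most [1 / m] relative to
   [H m / m]. *)
case: m tb => // M tb _ tb_valid; set m := M.+1; set N := (m ^ 3)%N.
have N0 : (0 < N)%N by rewrite expn_gt0.
pose p := @two_size_jobs R M N.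
have p0 i : 0 <= p i by exact: two_size_jobs_ge0.
have O1 : 1 <= OPT m p by exact: OPT_two_size.
have mR : 0 < m%:R :> R by rewrite ltr0n.
have m1 : 1 <= m%:R :> R by rewrite ler1n.
have H1 : 1 <= H m by exact: harmonic_ge1.
have H0 : 0 < H m by lra.
have rom0 : 0 < greedy_rom tb p.
  apply: lt_le_trans (greedy_rom_ge_OPT p0 tb_valid _) => //.
  by rewrite divr_gt0 ?mulr_gt0 //; lra.
apply: (@le_trans _ _ (Defs.ratio (OPT m p) (greedy_rom tb p))); last first.
  by apply: ereal_sup_ubound; exists (M + N)%N, p.
rewrite /Defs.ratio gt_eqF // lee_fin ler_pdivlMr //; apply: le_trans O1.
have c0 : 0 <= (1 - m%:R^-1) * m%:R / H m.
  by rewrite divr_ge0 ?mulr_ge0 ?(ltW H0) // subr_ge0 invf_le1 //.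
apply: (le_trans (ler_wpM2l c0 (greedy_rom_two_size N0 tb_valid))).
rewrite -/m -/(H m) natrX.
rewrite [X in X <= _](_ : _ = (1 - m%:R^-1) * (1 + m%:R^-1 / H m)); last first.
  by field; rewrite !gt_eqF.
set y := m%:R^-1.
have y0 : 0 <= y by rewrite invr_ge0 ltW.
have y1 : y <= 1 by rewrite invf_le1.
have yH : y / H m <= y by rewrite ler_pdivrMr // ler_peMr.
have : (1 - y) * (1 + y / H m) <= (1 - y) * (1 + y).
  by rewrite ler_wpM2l ?lerD2l // subr_ge0.
by have := mulr_ge0 y0 y0; lra.
Qed.

Local Open Scope classical_set_scope.

Lemma upper_eps_cvg0 : upper_eps n @[n --> \oo] --> (0 : R).
Proof.
apply/cvgr0Pnorm_lt => d d0.
near=> n.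
(* The condition [8 * sqrt (5 / H) < d] means [H > 320 / d ^+ 2]; 321 gives strictness. *)
have Hn : Num.max 80 (321 / d ^+ 2) <= H n.
  apply: le_trans (harmonic_ge_ln R n).
  rewrite -[X in X <= _]expRK ler_ln ?posrE ?expR_gt0 ?ltr0n //.
  apply: (@le_trans _ _ n%:R); last by rewrite ler_nat.
  by near: n; apply: nbhs_infty_ger.
move: Hn; rewrite ge_max => /andP[h80 hd].
have h0 : 0 < H n by lra.
rewrite /upper_eps (ltNge (H n) 80) h80 /= ger0_norm ?mulr_ge0 ?sqrtr_ge0 //.
rewrite -ltr_pdivlMl // [8^-1 * _]mulrC.
have d8 : 0 < d / 8 by rewrite divr_gt0.
rewrite -[d / 8]gtr0_norm // -sqrtr_sqr ltr_sqrt ?exprn_gt0 //.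
rewrite ltr_pdivrMr //; move: hd; rewrite ler_pdivrMr ?exprn_gt0 // => hd.
rewrite (_ : (d / 8) ^+ 2 = d ^+ 2 / 64); last by field.
lra.
Unshelve. all: by end_near.
Qed.

End CompetitiveRatio.

Local Open Scope classical_set_scope.

Theorem theorem4 (R : realType) :
  (* upper bound: (2 + o_m(1)) m / H_m *)
  (exists eps : nat -> R, eps n @[n --> \oo] --> (0:R) /\
     forall (m : nat) (tb : seq R -> ('I_m -> R) -> 'I_m),
       (0 < m)%N -> valid_tiebreak tb ->
       (greedy_cr tb <= ((2 + eps m) * m%:R / @harmonic_number R m)%:E)%E) /\
  (* lower bound: (1 - o_m(1)) m / H_m *)
  (exists delta : nat -> R, delta n @[n --> \oo] --> (0:R) /\
     forall (m : nat) (tb : seq R -> ('I_m -> R) -> 'I_m),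
       (0 < m)%N -> valid_tiebreak tb ->
       (((1 - delta m) * m%:R / @harmonic_number R m)%:E <= greedy_cr tb)%E) /\
  (* in particular Theta(m / log m) *)
  (exists c1 c2 : R, 0 < c1 /\ 0 < c2 /\
     forall (m : nat) (tb : seq R -> ('I_m -> R) -> 'I_m),
       (2 <= m)%N -> valid_tiebreak tb ->
       ((c1 * m%:R / ln m%:R)%:E <= greedy_cr tb)%E /\
       (greedy_cr tb <= (c2 * m%:R / ln m%:R)%:E)%E).
Proof.
split; last split.
- exists (upper_eps R); split; first exact: upper_eps_cvg0.
  by move=> m tb; apply: greedy_cr_le.
- exists (fun m => m%:R^-1); split; last by move=> m tb; apply: greedy_cr_ge.
  apply/cvgr0Pnorm_lt => d d0; near=> n.
  have n0 : 0 < n%:R :> R.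
    by rewrite ltr0n; near: n; exact: nbhs_infty_gt.
  rewrite ger0_norm ?invr_ge0 // invf_plt ?posrE //.
  by near: n; exact: nbhs_infty_gtr.
(* For [m >= 2], [1 - 1 / m >= 1 / 2] and [H <= 1 + ln m <= 3 * ln m] give 1/6; [upper_eps <= 160]
   and [ln m <= H] give 162. *)
- exists (1 / 6), 162; split; first by lra.
  split; first by lra.
  move=> m tb m2 tb_valid; have m0 : (0 < m)%N by exact: ltnW.
  have mR : 0 < m%:R :> R by rewrite ltr0n.
  (* This is [ln (1 + x) <= x] at [x = - 1 / 2]. *)
  have ln2 : 1 / 2 <= ln 2 :> R.
    have := @le_ln1Dx R (- (1 / 2)); rewrite (_ : 1 - 1 / 2 = 2^-1); last lra.
    by rewrite lnV ?posrE //; lra.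
  have lnm : ln 2 <= ln m%:R :> R.
    by rewrite ler_ln ?posrE // (ler_nat _ 2).
  have ln0 : 0 < ln m%:R :> R by lra.
  have H1 := harmonic_ge1 R m0.
  have H0 : 0 < harmonic_number R m by lra.
  split.
    apply: le_trans (greedy_cr_ge m0 tb_valid).
    rewrite lee_fin ler_pdivrMr // [X in _ <= X]mulrAC ler_pdivlMr //.
    have Hl := harmonic_le_ln R m0.
    have mV : m%:R^-1 <= 1 / 2 :> R.
      by rewrite div1r lef_pV2 ?posrE // (ler_nat _ 2).
    have h1 : m%:R * harmonic_number R m <= m%:R * (3 * ln m%:R).
      by rewrite ler_wpM2l ?ler0n //; lra.
    have h2 : 1 / 2 * (m%:R * ln m%:R) <=
              (1 - m%:R^-1) * (m%:R * ln m%:R) :> R.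
      apply: ler_wpM2r; last by lra.
      by rewrite mulr_ge0 // ltW.
    by lra.
  apply: (le_trans (greedy_cr_le m0 tb_valid)).
  have /andP[_ e160] := upper_eps_bounds R m0.
  have lnH : ln m%:R <= harmonic_number R m.
    apply: le_trans (harmonic_ge_ln R m).
    by rewrite ler_ln ?posrE ?ltr0n // ler_nat.
  rewrite lee_fin -!mulrA ler_pM //; first last.
  + by rewrite ler_pM2l // lef_pV2 ?posrE.
  + by lra.
  + by rewrite divr_ge0 // ltW.
  + by have /andP[e0 _] := upper_eps_bounds R m0; lra.
Unshelve. all: by end_near.
Qed.
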